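(* Let $(\mathfrak g,[\cdot,\cdot])$ be a finite-dimensional real semi-simple Lie algebra with Killing form $\mathbf k$. Regard $\mathfrak g$ as a pseudo-Riemannian manifold with the constant metric $\mathbf g=\mathbf k$, endowed with the Poisson bracket $$\{F,H\}_{\mathfrak g}(\xi)=\mathbf k\big(\xi,[\nabla F(\xi),\nabla H(\xi)]\big),\qquad F,H\in C^\infty(\mathfrak g),\ \xi\in\mathfrak g,$$ where $\nabla F$ denotes the gradient of $F$ with respect to $\mathbf k$. Then for every $G\in C^\infty(\mathfrak g)$ the generalized double bracket vector field $\mathbf v_G$ of $(\mathfrak g,\{\cdot,\cdot\}_{\mathfrak g},\mathbf k)$ satisfies $$\mathbf v_G(\xi)=[\xi,[\xi,\nabla G(\xi)]]\qquad\text{for all }\xi\in\mathfrak g.$$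
   Context: Let $(M,\mathbf g)$ be a finite-dimensional (pseudo-)Riemannian manifold endowed with a Poisson bracket $\{\cdot,\cdot\}$ on $C^\infty(M)$. Let $\boldsymbol\Pi$ be the associated skew-symmetric contravariant 2-tensor, $\boldsymbol\Pi(dF,dH)=\{F,H\}$, and let $\#_{\boldsymbol\Pi}:\Omega^1(M)\to\mathcal X(M)$ be the induced map, $\beta(\#_{\boldsymbol\Pi}\alpha)=\boldsymbol\Pi(\beta,\alpha)$; thus $\#_{\boldsymbol\Pi}dH=X_H$ is the Hamiltonian vector field of $H$, with $dF(X_H)=\{F,H\}$. (On $\mathfrak g$ with the bracket in the claim, $X_H(\xi)=-[\xi,\nabla H(\xi)]$.) The co-metric double bracket tensor is the symmetric contravariant 2-tensor $$\mathbf D(\alpha,\beta):=\mathbf g(\#_{\boldsymbol\Pi}\alpha,\#_{\boldsymbol\Pi}\beta),\qquad \alpha,\beta\in\Omega^1(M).$$ For $G\in C^\infty(M)$ the generalized double bracket vector field is $\mathbf v_G:=-\mathbf i_{dG}\mathbf D$, i.e. the vector field determined by $\alpha(\mathbf v_G)=-\mathbf D(dG,\alpha)$ for all $\alpha\in\Omega^1(M)$. The gradient with respect to $\mathbf k$ is defined by $\mathbf k(\nabla F(\xi),\eta)=dF(\xi)(\eta)$ for all $\eta\in\mathfrak g$. Tangent spaces of $\mathfrak g$ are identified with $\mathfrak g$. *)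

(* Defs.v *)
From HB Require Import structures.
From mathcomp Require Import all_boot all_order all_algebra.
From mathcomp Require Import all_classical all_reals all_analysis.

Set Implicit Arguments.
Unset Strict Implicit.
Unset Printing Implicit Defensive.

Import Order.TTheory GRing.Theory Num.Theory.
Import numFieldNormedType.Exports.

Local Open Scope classical_set_scope.
Local Open Scope ring_scope.

HB.mixin Record Vector_isLieAlgebra (K : fieldType) g & Vector K g := {
  lie : g -> g -> g;
  lie_is_linearl : forall y : g, linear (lie^~ y);
  lie_is_linearr : forall x : g, linear (lie x);
  liexx : forall x : g, lie x x = 0;
  lie_jacobi : forall x y z : g,
    lie x (lie y z) + lie y (lie z x) + lie z (lie x y) = 0
}.

#[short(type="lieAlgType")]
HB.structure Definition LieAlgebra (K : fieldType) :=
  {g of Vector_isLieAlgebra K g & Vector K g}.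

Notation "⁅ x , y ⁆" := (lie x y) (at level 0, format "⁅ x ,  y ⁆").

Section LieAlgebra.
Context {K : fieldType} {g : lieAlgType K}.

Definition lie_ideal (I : {vspace g}) : Prop :=
  forall x y : g, y \in I -> ⁅x, y⁆ \in I.

(* By bilinearity, brackets of basis vectors span [U, U]. *)
Definition lie_derived (U : {vspace g}) : {vspace g} :=
  <<[seq ⁅x, y⁆ | x <- vbasis U, y <- vbasis U]>>%VS.

Definition lie_solvable (U : {vspace g}) : Prop :=
  exists n : nat, iter n lie_derived U = 0%VS.

Definition ad (x : g) : 'End(g) := linfun (lie x).

Definition lfun_trace (f : 'End(g)) : K :=
  \tr (passmx.mxof (vbasis {:g}) (vbasis {:g}) f).

Definition killing (x y : g) : K := lfun_trace (ad x \o ad y)%VF.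

End LieAlgebra.

(* The solvable radical is zero. *)
Definition semisimple (K : fieldType) (g : lieAlgType K) : Prop :=
  forall I : {vspace g}, lie_ideal I -> lie_solvable I -> I = 0%VS.

Fixpoint Ck {R : realType} {n : nat} (k : nat) (f : 'rV[R]_n -> R) : Prop :=
  match k with
  | 0 => continuous f
  | k'.+1 => (forall x, differentiable f x) /\ (forall v, Ck k' ('D_v f))
  end.

(* Every tangent space is identified with [V], so a tangent vector is an
   element of [V], a covector an element of [covec V], a vector field a function
   [V -> V], and a tensor field takes its base point as first argument. *)
Section VectorSpaceManifold.
Context {R : realType} {V : vectType R}.

Definition covec := 'Hom(V, R).

(* A [vectType] carries no topology: calculus on [V] is done in the global chart
   given by the coordinates in a basis. Nothing depends on the basis chosen. *)
Local Notation chart := (passmx.rVof (vbasis {:V})).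

Definition in_chart (F : V -> R) : 'rV[R]_(\dim {:V}) -> R :=
  F \o passmx.vecof (vbasis {:V}).

Definition smooth (F : V -> R) : Prop := forall k, Ck k (in_chart F).

Definition dform (F : V -> R) (xi : V) : covec :=
  linfun ('d (in_chart F) (chart xi) \o chart).

(* The objects below are determined by a defining equation, and selected by
   [xget], which returns its first argument when the equation has no solution. *)

Definition grad (b : V -> V -> R) (F : V -> R) (xi : V) : V :=
  xget 0 [set v : V | forall eta : V, b v eta = dform F xi eta].

Section DoubleBracket.
Variables (pb : (V -> R) -> (V -> R) -> (V -> R)) (metric : V -> V -> V -> R).

Definition poisson_tensor (xi : V) : covec -> covec -> R :=
  xget (fun _ _ => 0)
    [set P : covec -> covec -> R |
      forall F H : V -> R, smooth F -> smooth H ->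
        P (dform F xi) (dform H xi) = pb F H xi].

Definition sharp (xi : V) (alpha : covec) : V :=
  xget 0 [set v : V | forall beta : covec,
    beta v = poisson_tensor xi beta alpha].

Definition cometric_tensor (xi : V) (alpha beta : covec) : R :=
  metric xi (sharp xi alpha) (sharp xi beta).

Definition double_bracket_field (G : V -> R) (xi : V) : V :=
  xget 0 [set v : V | forall alpha : covec,
    alpha v = - cometric_tensor xi (dform G xi) alpha].

End DoubleBracket.
End VectorSpaceManifold.

Section LiePoisson.
Context {R : realType} {g : lieAlgType R}.

Definition lie_poisson (F H : g -> R) (xi : g) : R :=
  killing xi ⁅grad killing F xi, grad killing H xi⁆.

Definition killing_metric (xi : g) : g -> g -> R := killing.

End LiePoisson.

(* Main.v *)
Require Import Defs.
From mathcomp Require Import all_boot all_order all_algebra.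
From mathcomp Require Import all_classical all_reals all_analysis.
From HB Require Import structures.
From mathcomp Require Import complex.

(** Once the Killing form [k] is nondegenerate the theorem is a computation.
    Each covector [alpha] is represented by a vector [a], [alpha = k(a, _)], and
    is the differential of a smooth function, so that the Poisson tensor is
    [(alpha, beta) |-> k(xi, ⁅a, b⁆)]. As [ad] is skew for [k], the sharp
    of [alpha] is [- ⁅xi, a⁆], and the equation defining the double bracket
    field becomes
    [k(a, v) = - k(⁅xi, grad G⁆, ⁅xi, a⁆) = k(a, ⁅xi, ⁅xi, grad G⁆⁆)]
    for all [a].

    Semisimplicity is the vanishing of the solvable radical, so that the
    substance of the proof is Cartan's criterion: the radical [N] of [k] is a
    solvable ideal, hence zero ([semisimple_killing_radical]). Two facts give
    it.

    First, [ad x] is nilpotent for [x] in [⁅N, N⁆]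
    ([derived_radical_nilpotent]). Invariance of the trace shows that
    [ad x] times [D] has trace zero for every derivation [D] of the
    complexification of the algebra ([trace_derived_radical]). Take for [D] the
    endomorphism acting on the generalized eigenspace of [ad x] for [a] as the
    conjugate of [a]; as conjugation is additive and brackets add eigenvalues,
    [D] is a derivation ([conjugate_derivation]). The trace is then the sum of
    the squared moduli of the eigenvalues of [ad x], which are therefore all
    zero.

    Second, a subalgebra of [ad]-nilpotent elements is solvable
    ([ad_nilpotent_solvable]), by Engel's theorem ([engel]). *)

Set Implicit Arguments.
Unset Strict Implicit.
Unset Printing Implicit Defensive.

Import Order.TTheory GRing.Theory Num.Theory.
Import numFieldNormedType.Exports.
Import passmx.

Local Open Scope ring_scope.

(** * The derivation conjugate to a derivation *)

Section TriangularMatrices.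
Variables (F : fieldType) (n : nat).
Implicit Types (T : 'M[F]_n.+1) (q : {poly F}).

Lemma trig_mulmx_diag T1 T2 : is_trig_mx T1 -> is_trig_mx T2 ->
  is_trig_mx (T1 *m T2) /\ forall i, (T1 *m T2) i i = T1 i i * T2 i i.
Proof.
move=> /is_trig_mxP T1trig /is_trig_mxP T2trig; split=> [|i].
  apply/is_trig_mxP => i j lt_ij; rewrite mxE big1 // => k _.
  have [lt_ik|le_ki] := ltnP i k; first by rewrite T1trig ?mul0r.
  by rewrite T2trig ?mulr0 // (leq_ltn_trans le_ki).
rewrite mxE (bigD1 i) //= big1 ?addr0 // => k neq_ki.
have [lt_ik|lt_ki|eq_ik] := ltngtP i k.
- by rewrite T1trig ?mul0r.
- by rewrite T2trig ?mulr0.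
- by rewrite (val_inj eq_ik) eqxx in neq_ki.
Qed.

Lemma trig_horner_mx T q : is_trig_mx T ->
  is_trig_mx (horner_mx T q) /\ forall i, horner_mx T q i i = q.[T i i].
Proof.
move=> Ttrig; elim/poly_ind: q => [|q c [qT_trig qT_diag]].
  by rewrite rmorph0 mx0_is_trig; split=> // i; rewrite mxE horner0.
have [/is_trig_mxP qTT_trig qTT_diag] := trig_mulmx_diag qT_trig Ttrig.
rewrite rmorphD rmorphM /= horner_mx_X horner_mx_C -mulmxE; split=> [|i].
  apply/is_trig_mxP => i j lt_ij; rewrite mxE qTT_trig // mxE.
  by rewrite -val_eqE ltn_eqF // addr0.
by rewrite mxE qTT_diag qT_diag mxE eqxx !hornerE.
Qed.

End TriangularMatrices.

(** Both claims are read off the diagonal of a Schur triangular form of [X]: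
    the [a i] are the eigenvalues of [X], repeated with multiplicity. *)
Lemma char_poly_split_trace (C : numClosedFieldType) n (X : 'M[C]_n.+1) :
  exists a : 'I_n.+1 -> C,
    horner_mx X (\prod_i ('X - (a i)%:P)) = 0 /\
    forall q, \tr (horner_mx X q) = \sum_i q.[a i].
Proof.
have [P Punitary] := Schur X (ltn0Sn n).
have Punit : P \in unitmx by apply: unitarymx_unit.
rewrite /similar_to /= conjumx //; set T := _ *m _ => Ttrig.
have XE : X = invmx P *m T *m P by rewrite /T !mulmxA mulVmx // mul1mx mulmxKV.
have hE q : horner_mx X q = invmx P *m horner_mx T q *m P.
  by rewrite XE horner_mx_uconjC.
exists (fun i => T i i); split=> [|q].
  by rewrite -char_poly_trig // hE Cayley_Hamilton mulmx0 mul0mx.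
rewrite hE mxtrace_mulC mulmxA mulmxV // mul1mx.
by apply: eq_bigr => i _; rewrite (trig_horner_mx q Ttrig).2.
Qed.

Section CoprimeFamilies.
Variables (F : fieldType) (I : finType) (q : I -> {poly F}).
Hypothesis q_coprime : forall i j, j != i -> coprimep (q i) (q j).

Lemma coprimep_prodr (p : {poly F}) (P : pred I) :
  (forall i, P i -> coprimep p (q i)) -> coprimep p (\prod_(i | P i) q i).
Proof.
move=> cop; elim/big_ind: _ => [|r t|//]; first exact: coprimep1.
by rewrite coprimepMr => ->.
Qed.

Lemma dvdp_prod (p : {poly F}) (P : pred I) :
  (forall i, P i -> q i %| p) -> \prod_(i | P i) q i %| p.
Proof.
move=> q_dvd; elim: index_enum (index_enum_uniq I) => [|i r IHr] /=.
  by rewrite big_nil dvd1p.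
case/andP=> iNr r_uniq; rewrite big_cons; case: ifP => [Pi|_]; last exact: IHr.
rewrite Gauss_dvdp ?q_dvd ?IHr //.
rewrite big_seq_cond; elim/big_ind: _ => [|s t|j]; rewrite ?coprimep1 //.
  by rewrite coprimepMr => -> ->.
by case/andP=> jr _; apply: q_coprime; apply: contraNneq iNr => <-.
Qed.

(** The polynomials behind the Chinese remainder theorem: evaluated at an
    endomorphism killed by the product of the [q i], the [p i] are the
    projections onto the kernels of the [q i]. *)
Lemma orthogonal_poly_family : exists p : I -> {poly F},
  [/\ forall i, q i %| p i - 1, forall i j, j != i -> q j %| p i
    & \prod_i q i %| \sum_i p i - 1].
Proof.
have /fin_all_exists [p pP] i : exists p,
    q i %| p - 1 /\ \prod_(j | j != i) q j %| p.
  have /Bezout_eq1_coprimepP [[u v] /= uv1] :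
      coprimep (q i) (\prod_(j | j != i) q j).
    by apply: coprimep_prodr => j; apply: q_coprime.
  exists (v * \prod_(j | j != i) q j); split; last exact: dvdp_mull.
  by rewrite -[v * _](addKr (u * q i)) uv1 addrK -mulNr dvdp_mull.
have p_mod i j : j != i -> q j %| p i.
  by move=> neq_ji; apply: dvdp_trans (pP i).2; rewrite (bigD1 j) //= dvdp_mulr.
exists p; split=> // [i|]; first by case: (pP i).
apply: dvdp_prod => i _.
rewrite (bigD1 i) //= addrAC dvdp_addr ?(pP i).1 //.
elim/big_ind: _ => [|x y|j neq_ji]; [exact: dvdp0 | exact: dvdp_add | ].
by apply: p_mod; rewrite eq_sym.
Qed.

End CoprimeFamilies.

Lemma horner_mx_XsubC_exp (F : fieldType) n (X : 'M[F]_n.+1) a k :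
  horner_mx X (('X - a%:P) ^+ k) = (X - a%:M) ^+ k.
Proof. by rewrite rmorphXn rmorphB /= horner_mx_X horner_mx_C. Qed.

Lemma horner_mx_dvdp (F : fieldType) n (X : 'M[F]_n.+1) (w : 'rV_n.+1) p q :
  p %| q -> w *m horner_mx X p = 0 -> w *m horner_mx X q = 0.
Proof.
case/dvdpP=> r -> w0.
by rewrite mulrC rmorphM -mulmxE mulmxA w0 mul0mx.
Qed.

(** [p] interpolates complex conjugation on the spectrum of [X] so that [p(X)]
    acts on each generalized eigenspace as the scalar conjugate to the
    eigenvalue. If [a] runs through the eigenvalues, then [X p(X)] has trace
    [\sum_i `|a i| ^+ 2], which vanishes only if all the [a i] do.

    The space is a sum of vectors killed by powers [n.+1], whereas [p(X)] is
    controlled on vectors killed by powers twice as high. The bracket of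
    generalized eigenvectors adds these exponents, so that it stays in the range
    where [p(X)] is known. In the first claim [a] need not be an eigenvalue;
    this covers a sum of two eigenvalues that is not one. *)
Lemma conjugate_poly (C : numClosedFieldType) n (X : 'M[C]_n.+1) :
  exists p : {poly C},
  [/\ forall a (w : 'rV_n.+1), w *m (X - a%:M) ^+ (n.+1 + n.+1) = 0 ->
         w *m horner_mx X p = a^* *: w,
      forall (w : 'rV_n.+1),
         exists (I : finType) (a : I -> C) (w_ : I -> 'rV_n.+1),
         w = \sum_i w_ i /\ forall i, w_ i *m (X - (a i)%:M) ^+ n.+1 = 0
    & \tr (X *m horner_mx X p) = 0 -> X ^+ n.+1 = 0].
Proof.
have [a [annX trX]] := char_poly_split_trace X; set N := n.+1 in a annX trX *.
pose I := seq_sub (codom a); pose r k (x : I) := ('X - (val x)%:P) ^+ k.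
have aI i : a i \in codom a by apply: codom_f.
pose b i : I := SeqSub (aI i).
have r_coprime k x y : y != x -> coprimep (r k x) (r k y).
  move=> neq_yx; rewrite coprimep_expl ?coprimep_expr // coprimep_XsubC2 //.
  by rewrite subr_eq0 (inj_eq val_inj).
have annr k : (N <= k)%N -> horner_mx X (\prod_x r k x) = 0.
  move=> le_Nk; apply/row_matrixP => i; rewrite rowE row0.
  apply: (horner_mx_dvdp (p := \prod_i ('X - (a i)%:P))); last first.
    by rewrite annX mulmx0.
  rewrite (partition_big b predT) //=.
  elim/big_ind2: _ => // [????|x _]; first exact: dvdp_mul.
  rewrite (eq_bigr (fun=> 'X - (val x)%:P)) => [|j /eqP <- //].
  by rewrite prodr_const dvdp_exp2l // (leq_trans (max_card _)) // card_ord.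
have [p [p_diag p_off p_sum]] := orthogonal_poly_family (r_coprime (N + N)%N).
pose P := \sum_x (val x)^* *: p x.
have P_mod x : r (N + N)%N x %| P - ((val x)^*)%:P.
  rewrite /P (bigD1 x) //= addrAC dvdp_addr.
    elim/big_ind: _ => [|? ?|y neq_yx]; [exact: dvdp0 | exact: dvdp_add | ].
    by rewrite -mul_polyC dvdp_mull // p_off // eq_sym.
  by rewrite -mul_polyC -[X in _ - X]mulr1 -mulrBr dvdp_mull.
have hx1 (w : 'rV_N) : w *m horner_mx X 1 = w by rewrite rmorph1 mulmx1.
exists P; split.
- move=> c w wc.
  have wc' : w *m horner_mx X (('X - c%:P) ^+ (N + N)) = 0.
    by rewrite horner_mx_XsubC_exp.
  have [cI|cNI] := boolP (c \in codom a).
    have := horner_mx_dvdp (P_mod (SeqSub cI)) wc'.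
    rewrite rmorphB /= horner_mx_C mulmxBr mul_mx_scalar => /eqP.
    by rewrite subr_eq0 => /eqP.
  (* Off the spectrum, [X - c] is invertible. *)
  suff -> : w = 0 by rewrite mul0mx scaler0.
  have /Bezout_eq1_coprimepP [[u v] /= uv1] :
      coprimep (('X - c%:P) ^+ (N + N)) (\prod_x r (N + N)%N x).
    apply: coprimep_prodr => x _; rewrite coprimep_expl ?coprimep_expr //.
    rewrite coprimep_XsubC2 // subr_eq0; apply: contraNneq cNI => <-.
    exact: valP.
  rewrite -[w]hx1 -uv1 rmorphD !rmorphM /= annr ?leq_addr //.
  rewrite mulr0 addr0 -rmorphM /=; apply: horner_mx_dvdp wc'.
  exact: dvdp_mull.
- move=> w; exists I, val, (fun x => w *m horner_mx X (p x)); split=> [|x].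
    rewrite -mulmx_sumr -rmorph_sum; apply/eqP; rewrite eq_sym -subr_eq0.
    rewrite -[X in _ - X]hx1 -mulmxBr -rmorphB.
    by apply/eqP; apply: horner_mx_dvdp p_sum _; rewrite annr ?mulmx0 ?leq_addr.
  rewrite -mulmxA -horner_mx_XsubC_exp mulmxE -rmorphM /=.
  apply: (horner_mx_dvdp (p := \prod_x r N x)); last by rewrite annr // mulmx0.
  rewrite (bigD1 x) //= mulrC dvdp_mul //.
  apply: dvdp_prod => [y z|y neq_yx]; first exact: r_coprime.
  by apply: dvdp_trans (p_off _ _ neq_yx); rewrite dvdp_exp2l // leq_addr.
- rewrite -{1}(horner_mx_X X) mulmxE -rmorphM /= trX.
  have Pa i : P.[a i] = (a i)^*.
    have : 'X - (a i)%:P %| r (N + N)%N (b i).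
      by rewrite -[X in X %| _]expr1 dvdp_exp2l.
    move=> /dvdp_trans /(_ (P_mod (b i))).
    by rewrite dvdp_XsubCl rootE !hornerE subr_eq0 => /eqP.
  under eq_bigr do rewrite hornerM hornerX Pa -normCK.
  move/eqP; rewrite psumr_eq0 => [/allP a0|i _]; last exact: exprn_ge0.
  have {}a0 i : a i = 0.
    by apply/eqP; have := a0 i (mem_index_enum _); rewrite expf_eq0 normr_eq0.
  move: annX; under eq_bigr do rewrite a0 subr0.
  by rewrite prodr_const card_ord rmorphXn /= horner_mx_X.
Qed.

(** [B] encodes a bilinear product on row vectors, [B v] being the matrix of
    multiplication by [v], so that the product of [v] and [u] is [u *m B v].
    The formula below is the Leibniz rule for [X] acting on the right. *)
Definition product_derivation (F : fieldType) n (B : 'rV[F]_n -> 'M[F]_n)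
    (X : 'M[F]_n) := forall v, B (v *m X) = B v *m X - X *m B v.

Section ConjugateDerivation.
Variables (C : numClosedFieldType) (n' : nat).
Local Notation n := n'.+1.
Variable B : {linear 'rV[C]_n -> 'M[C]_n}.
Implicit Types (X D : 'M[C]_n) (u v w : 'rV[C]_n) (a b c : C).

(** By the Leibniz rule, applying [X - (a + b)] to a product is the sum of
    applying [X - b] to one factor and [X - a] to the other. *)
Lemma geigen_product X a b i j u v : product_derivation B X ->
  u *m (X - b%:M) ^+ i = 0 -> v *m (X - a%:M) ^+ j = 0 ->
  u *m B v *m (X - (a + b)%:M) ^+ (i + j) = 0.
Proof.
move=> derX.
have [k] := ubnP (i + j); elim: k => // k IHk in i j u v *.
case: i => [|i]; first by rewrite expr0 mulmx1 => _ ->; rewrite !mul0mx.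
case: j => [|j].
  by rewrite expr0 mulmx1 => _ _ ->; rewrite linear0 mulmx0 mul0mx.
rewrite addSn !ltnS => le_k; rewrite [_ ^+ i.+1]exprS [_ ^+ j.+1]exprS.
rewrite -!mulmxE !mulmxA => u0 v0.
have -> : u *m B v *m (X - (a + b)%:M) ^+ (i + j.+1).+1 =
  (u *m (X - b%:M)) *m B v *m (X - (a + b)%:M) ^+ (i + j.+1) +
  u *m B (v *m (X - a%:M)) *m (X - (a + b)%:M) ^+ (i + j.+1).
  rewrite exprS -mulmxE mulmxA -mulmxDl; congr (_ *m _).
  rewrite !mulmxBr linearB /= derX !mul_mx_scalar [B (a *: v)]linearZ /=.
  rewrite mulmxBl !mulmxBr -scalemxAl -scalemxAr !mulmxA scalerDl opprD.
  by rewrite [RHS]addrC [RHS]addrACA subrK.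
have vS : v *m (X - a%:M) ^+ j.+1 = 0 by rewrite exprS -mulmxE mulmxA.
have uS : u *m (X - b%:M) ^+ i.+1 = 0 by rewrite exprS -mulmxE mulmxA.
rewrite (IHk i j.+1 _ _ le_k u0 vS) add0r addnS -addSn.
by apply: IHk => //; rewrite addSn -addnS.
Qed.

(** [D] is the polynomial in [X] of [conjugate_poly]. It is a derivation
    because conjugation is additive: on a product of generalized eigenvectors
    for [a] and [b] both sides of the Leibniz rule multiply by the conjugate of
    [a + b], and such products suffice by bilinearity. *)
Lemma conjugate_derivationS X : product_derivation B X ->
  exists2 D, product_derivation B D & \tr (X *m D) = 0 -> X ^+ n = 0.
Proof.
move=> derX; have [p [p_conj decomp trX]] := conjugate_poly X.
exists (horner_mx X p); last exact: trX.
set D := horner_mx X p in p_conj *.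
pose defect v := B (v *m D) - (B v *m D - D *m B v).
suff defect0 v u : u *m defect v = 0.
  move=> v; apply/eqP; rewrite -subr_eq0; apply/eqP/row_matrixP => i.
  by rewrite rowE defect0 row0.
have [I [a [v_ [-> v_gen]]]] := decomp v.
have [J [b [u_ [-> u_gen]]]] := decomp u.
rewrite mulmx_suml big1 // => j _.
have -> : defect (\sum_i v_ i) = \sum_i defect (v_ i).
  rewrite /defect mulmx_suml !(raddf_sum B) /= mulmx_suml mulmx_sumr.
  by rewrite -!sumrB.
rewrite mulmx_sumr big1 // => i _; rewrite /defect !mulmxBr !mulmxA.
have D_eigen c w : w *m (X - c%:M) ^+ n = 0 -> w *m D = c^* *: w.
  by move=> w0; apply: p_conj; rewrite exprD -mulmxE mulmxA w0 mul0mx.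
rewrite (D_eigen _ _ (u_gen j)) (D_eigen _ _ (v_gen i)).
rewrite (p_conj _ _ (geigen_product derX (u_gen j) (v_gen i))).
rewrite [B (_ *: _)]linearZ /= -scalemxAl -scalemxAr rmorphD scalerDl.
by rewrite addrK subrr.
Qed.

End ConjugateDerivation.

Lemma conjugate_derivation (C : numClosedFieldType) n
    (B : {linear 'rV[C]_n -> 'M[C]_n}) (X : 'M[C]_n) : product_derivation B X ->
  exists2 D, product_derivation B D &
    \tr (X *m D) = 0 -> forall v : 'rV_n, iter n (mulmxr X) v = 0.
Proof.
case: n B X => [|n] B X derX; first by exists X => // _ v; rewrite thinmx0.
have [D derD trXD] := conjugate_derivationS derX.
exists D => // /trXD Xn0 v.
suff iterE k : iter k (mulmxr X) v = v *m X ^+ k by rewrite iterE Xn0 mulmx0.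
elim: k => [|k IHk]; first by rewrite expr0 mulmx1.
by rewrite iterS IHk exprSr -mulmxE mulmxA.
Qed.

(** * Lie brackets and the Killing form *)

HB.instance Definition _ (K : fieldType) (g : lieAlgType K) (x : g) :=
  GRing.isLinear.Build K g g *:%R (lie x) (lie_is_linearr x).

Section LieBasics.
Variables (K : fieldType) (g : lieAlgType K).
Implicit Types (x y z : g).
Local Notation e := (vbasis {:g}).

Lemma adE x y : ad x y = ⁅x, y⁆. Proof. by rewrite lfunE. Qed.

Lemma lieDl x y z : ⁅x + y, z⁆ = ⁅x, z⁆ + ⁅y, z⁆.
Proof. by have := lie_is_linearl z 1 x y; rewrite !scale1r. Qed.

Lemma lieZl (a : K) x z : ⁅a *: x, z⁆ = a *: ⁅x, z⁆.
Proof.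
have lie0 : ⁅0, z⁆ = 0.
  by apply: (addrI ⁅0, z⁆); rewrite -lieDl !addr0.
by have := lie_is_linearl z a x 0; rewrite !addr0 lie0 addr0.
Qed.

Lemma lieC x y : ⁅x, y⁆ = - ⁅y, x⁆.
Proof.
have := liexx (x + y); rewrite lieDl !linearD /= !liexx add0r addr0.
by move/eqP; rewrite addr_eq0 => /eqP.
Qed.

Lemma lie_derivation x y z : ⁅x, ⁅y, z⁆⁆ = ⁅⁅x, y⁆, z⁆ + ⁅y, ⁅x, z⁆⁆.
Proof.
have /eqP := lie_jacobi x y z.
rewrite (lieC z x) (lieC z ⁅x, y⁆) linearN /= -addrA addr_eq0 opprD !opprK.
by rewrite addrC => /eqP.
Qed.

Lemma ad_is_linear : linear (@ad K g).
Proof.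
move=> a x y; apply/lfunP => z.
by rewrite add_lfunE scale_lfunE !adE lieDl lieZl.
Qed.
HB.instance Definition _ :=
  GRing.isLinear.Build K g 'End(g) *:%R (@ad K g) ad_is_linear.

Definition ad_mx x : 'M[K]_(\dim {:g}) := mxof e e (ad x).

Lemma ad_mx_is_linear : linear ad_mx.
Proof. by move=> a x y; rewrite /ad_mx !linearP. Qed.
HB.instance Definition _ :=
  GRing.isLinear.Build K g 'M[K]_(\dim {:g}) *:%R ad_mx ad_mx_is_linear.

Let e_basis : basis_of {:g} e. Proof. exact: vbasisP. Qed.

Lemma mul_ad_mx x y : rVof e y *m ad_mx x = rVof e ⁅x, y⁆.
Proof. by rewrite -adE (rVof_app _ e_basis). Qed.

(** The order on the right is reversed because matrices act on row vectors. *)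
Lemma ad_mx_lie x y :
  ad_mx ⁅x, y⁆ = ad_mx y *m ad_mx x - ad_mx x *m ad_mx y.
Proof.
apply/row_matrixP => i; rewrite !rowE mulmxBr !mulmxA.
rewrite -(rVofE e_basis) !mul_ad_mx.
by rewrite -linearB /= [in RHS]lie_derivation addrK.
Qed.

Lemma killingE x y : killing x y = \tr (ad_mx y *m ad_mx x).
Proof. by rewrite /killing /lfun_trace (mxof_comp _ _ e_basis). Qed.

Lemma killingC x y : killing x y = killing y x.
Proof. by rewrite !killingE mxtrace_mulC. Qed.

Lemma killing_is_linear x : linear (killing x : g -> K^o).
Proof.
move=> a y z; rewrite !killingE linearP /=.
by rewrite mulmxDl -scalemxAl mxtraceD mxtraceZ.
Qed.
HB.instance Definition _ x :=
  GRing.isLinear.Build K g K^o *:%R (killing x : g -> K^o)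
    (killing_is_linear x).

Lemma killing_invariant x y z : killing ⁅x, y⁆ z = killing x ⁅y, z⁆.
Proof.
rewrite !killingE !ad_mx_lie mulmxBr mulmxBl !raddfB /= !mulmxA; congr (_ + _).
by congr (- _); rewrite mxtrace_mulC mulmxA.
Qed.

Lemma killingNr x y : killing x (- y) = - killing x y.
Proof. exact: linearN. Qed.

Lemma killing_ad_skew x y z : killing ⁅x, y⁆ z = - killing y ⁅x, z⁆.
Proof. by rewrite lieC killingC killingNr killingC killing_invariant. Qed.

End LieBasics.

Lemma span_ind (K : fieldType) (V : vectType K) (X : seq V) (P : V -> Prop) :
  P 0 -> (forall a u v, P u -> P v -> P (a *: u + v)) ->
  (forall u, u \in X -> P u) -> forall u, u \in <<X>>%VS -> P u.
Proof.
move=> P0 Plin PX u /(@coord_span _ _ _ (in_tuple X)) ->.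
elim/big_rec: _ => // i v _ Pv; apply: Plin => //; apply: PX.
by rewrite mem_nth // size_tuple.
Qed.

Section KillingRadical.
Variables (K : fieldType) (g : lieAlgType K).
Implicit Types (x y z : g).

Definition killing_flat x : 'Hom(g, K^o) := linfun (killing x : g -> K^o).

Lemma killing_flatE x y : killing_flat x y = killing x y.
Proof. by rewrite lfunE. Qed.

Lemma killing_flat_is_linear : linear killing_flat.
Proof.
move=> a x y; apply/lfunP => z; rewrite add_lfunE scale_lfunE !killing_flatE.
by rewrite ![killing _ z]killingC linearP.
Qed.
HB.instance Definition _ :=
  GRing.isLinear.Build K g 'Hom(g, K^o) *:%R killing_flat
    killing_flat_is_linear.

Definition killing_radical : {vspace g} := lker (linfun killing_flat).

Lemma killing_radicalP x :
  reflect (forall y, killing x y = 0) (x \in killing_radical).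
Proof.
rewrite memv_ker lfunE /=; apply: (iffP eqP) => [x0 y|x0].
  by rewrite -killing_flatE x0 zero_lfunE.
by apply/lfunP => y; rewrite killing_flatE x0 zero_lfunE.
Qed.

Lemma killing_radical_ideal : lie_ideal killing_radical.
Proof.
move=> x y /killing_radicalP y0; apply/killing_radicalP => z.
by rewrite lieC killingC killingNr killingC killing_invariant y0 oppr0.
Qed.

(** An injective map from [g] to its dual is surjective, by dimension. *)
Lemma killing_repr : killing_radical = 0%VS ->
  forall alpha : 'Hom(g, K^o), exists v, forall x, killing v x = alpha x.
Proof.
move=> rad0 alpha.
have /memv_imgP [v _ ->] : alpha \in limg (linfun killing_flat).
  suff -> : limg (linfun killing_flat) = fullv by rewrite memvf.
  apply/eqP; rewrite eqEdim subvf /=.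
  have := limg_ker_dim (linfun killing_flat) fullv.
  rewrite -/killing_radical rad0 capv0 dimv0 add0n => ->.
  by rewrite !dimvf /dim /= muln1.
by exists v => x; rewrite lfunE /= killing_flatE.
Qed.

End KillingRadical.

Definition ad_nilpotent (K : fieldType) (g : lieAlgType K) (x : g) :=
  exists k, forall y, iter k (lie x) y = 0.

(** * Trace orthogonality forces nilpotency *)

Section CartanCriterion.
Variables (R : rcfType) (g : lieAlgType R).
Local Notation n := (\dim {:g}).
Local Notation e := (vbasis {:g}).
Local Notation toC := (real_complex R).
Let e_basis : basis_of {:g} e. Proof. exact: vbasisP. Qed.

(** The matrix of [ad x] on the complexification of [g], with coordinates in
    the fixed real basis; [bracketC] is [ad] for complex arguments. *)
Definition ad_mxC (x : g) : 'M[R[i]]_n := map_mx toC (ad_mx x).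

Definition bracketC (c : 'rV[R[i]]_n) : 'M[R[i]]_n :=
  \sum_i c 0 i *: ad_mxC e`_i.

Lemma bracketC_is_linear : linear bracketC.
Proof.
move=> a c d; rewrite /bracketC scaler_sumr -big_split /=.
by apply: eq_bigr => i _; rewrite !mxE scalerDl scalerA.
Qed.
HB.instance Definition _ := GRing.isLinear.Build R[i] 'rV[R[i]]_n 'M[R[i]]_n
  *:%R bracketC bracketC_is_linear.

Lemma bracketC_rVof x : bracketC (map_mx toC (rVof e x)) = ad_mxC x.
Proof.
rewrite -{2}(rVofK e_basis x) /vecof /ad_mxC linear_sum /= raddf_sum /=.
by apply: eq_bigr => i _; rewrite linearZ /= map_mxZ mxE.
Qed.

Lemma ad_mxC_derivation x : product_derivation bracketC (ad_mxC x).
Proof.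
move=> c; rewrite (row_sum_delta c).
rewrite mulmx_suml !(linear_sum bracketC) /= mulmx_suml mulmx_sumr -sumrB.
apply: eq_bigr => i _; rewrite -scalemxAl ![bracketC (_ *: _)]linearZ /=.
rewrite -scalemxAl -scalemxAr -scalerBr.
congr (_ *: _); have -> : delta_mx 0 i = map_mx toC (rVof e e`_i).
  by rewrite (rVofE e_basis) map_delta_mx.
rewrite -map_mxM mul_ad_mx !bracketC_rVof /ad_mxC.
by rewrite -!map_mxM -map_mxB ad_mx_lie.
Qed.

(** For [x = ⁅u, v⁆] cyclicity of the trace turns [\tr (ad x D)] into
    the trace of [ad u] times the commutator of [ad v] with [D]. That commutator
    is, up to sign, [ad] of the complex vector [D v], so that the trace is a
    complex combination of the numbers [killing u e`_i], which vanish as [u] is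
    in the radical of the Killing form. *)
Lemma trace_derived_radical x D : x \in lie_derived (killing_radical g) ->
  product_derivation bracketC D -> \tr (ad_mxC x *m D) = 0.
Proof.
move=> x_der derD.
have radP v : v \in vbasis (killing_radical g) -> forall y, killing v y = 0.
  by move=> /vbasis_mem /killing_radicalP.
move: x x_der; apply: span_ind => [|a x y x0 y0|z].
- by rewrite /ad_mxC linear0 map_mx0 mul0mx mxtrace0.
- rewrite /ad_mxC linearP map_mxD map_mxZ mulmxDl -scalemxAl.
  by rewrite mxtraceD mxtraceZ x0 y0 mulr0 addr0.
case/allpairsP => -[u v] /= [/radP u0 _ ->].
have trU c : \tr (ad_mxC u *m bracketC c) = 0.
  rewrite /bracketC mulmx_sumr raddf_sum /= big1 // => i _.
  rewrite -scalemxAr mxtraceZ /ad_mxC -map_mxM trace_map_mx -killingE killingC.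
  by rewrite u0 rmorph0 mulr0.
rewrite /ad_mxC ad_mx_lie map_mxB !map_mxM -!/(ad_mxC _) mulmxBl raddfB /=.
rewrite -mulmxA mxtrace_mulC -[X in _ - \tr X]mulmxA -raddfB /=.
rewrite -mulmxA -mulmxBr.
by rewrite -opprB mulmxN -(bracketC_rVof v) -derD raddfN /= trU oppr0.
Qed.

(** The derivation [ad x] has a conjugate derivation of the complexified
    algebra, and [trace_derived_radical] says that their product has trace
    zero. *)
Lemma derived_radical_nilpotent x :
  x \in lie_derived (killing_radical g) -> ad_nilpotent x.
Proof.
move=> x_der; have [D derD trXD] := conjugate_derivation (ad_mxC_derivation x).
have nilX := trXD (trace_derived_radical x_der derD).
exists n => y; apply/eqP; rewrite -(rVof_eq0 e_basis); apply/eqP.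
apply: (@map_mx_inj _ _ toC).
rewrite map_mx0 -[RHS](nilX (map_mx toC (rVof e y))).
suff iterE k : map_mx toC (rVof e (iter k (lie x) y)) =
  iter k (mulmxr (ad_mxC x)) (map_mx toC (rVof e y)) by [].
by elim: k => //= k <-; rewrite -mul_ad_mx map_mxM.
Qed.

End CartanCriterion.

(** * Engel's theorem and Cartan's criterion *)

Section Engel.
Variables (K : fieldType) (g : lieAlgType K).
Implicit Types (x y z v w : g) (U A B L : {vspace g}).

Definition normalizes U A := forall x y, x \in U -> y \in A -> ⁅x, y⁆ \in A.

Lemma mem_lie_derived U x y : x \in U -> y \in U -> ⁅x, y⁆ \in lie_derived U.
Proof.
rewrite -{1 2}(span_basis (vbasisP U)) => xU yU; move: x xU.
apply: span_ind => [|a x x' xD x'D|x xU].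
- by rewrite -[0](scale0r 0) lieZl scale0r mem0v.
- by rewrite lieDl lieZl memvD ?memvZ.
move: y yU; apply: span_ind => [|a y y' yD y'D|y yU].
- by rewrite linear0 mem0v.
- by rewrite linearP memvD ?memvZ.
by apply: memv_span; apply/allpairsP; exists (x, y).
Qed.

Lemma lie_derived_sub U B :
  (forall x y, x \in U -> y \in U -> ⁅x, y⁆ \in B) -> (lie_derived U <= B)%VS.
Proof.
move=> UB; apply/span_subvP => _ /allpairsP [[x y] /= [xU yU ->]].
by apply: UB; apply: vbasis_mem.
Qed.

Lemma dim_addv_line U v : v \notin U -> \dim (U + <[v]>) = (\dim U).+1.
Proof.
move=> vU; have v_neq0 : v != 0 by apply: contraNneq vU => ->; rewrite mem0v.
apply/eqP; rewrite eqn_leq; apply/andP; split.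
  by rewrite (leq_trans (dimv_add_leqif _ _).1) // dim_vline v_neq0 addn1.
rewrite (ltn_leqif (dimv_leqif_sup (addvSl U <[v]>))).
by apply: contra vU => /subvP; apply; rewrite (subvP (addvSr _ _)) ?memv_line.
Qed.

Lemma memv_add_lineP U v w :
  reflect (exists2 u, u \in U & exists c, w = u + c *: v) (w \in U + <[v]>)%VS.
Proof.
apply: (iffP memv_addP) => [[u uU [_ /vlineP [c ->] ->]]|[u uU [c ->]]].
  by exists u => //; exists c.
by exists u => //; exists (c *: v); rewrite // memvZ ?memv_line.
Qed.

(** Every nonzero quotient [A / B] of [U]-modules contained in [g] has a nonzero
    vector killed by [U]. Pairs of subspaces stand for quotients. *)
Definition invariants_in_quotients U := forall A B,
  normalizes U A -> normalizes U B -> (B <= A)%VS -> ~~ (A <= B)%VS ->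
  exists v, [/\ v \in A, v \notin B & forall x, x \in U -> ⁅x, v⁆ \in B].

(** The vectors of [A] that [U] sends into [B] are stable under [z]. The last
    iterate of [z] outside [B], starting from such a vector, is sent into [B] by
    [z] as well. *)
Lemma invariants_in_quotients_line U z : ad_nilpotent z -> normalizes U U ->
  (forall x, x \in U -> ⁅x, z⁆ \in U) -> invariants_in_quotients U ->
  invariants_in_quotients (U + <[z]>).
Proof.
move=> [k z_nil] UU Uz wU A B nA nB sBA AB.
have sU : (U <= U + <[z]>)%VS := addvSl _ _.
have zU' : z \in (U + <[z]>)%VS by rewrite (subvP (addvSr _ _)) ?memv_line.
have nUA : normalizes U A by move=> x y /(subvP sU); apply: nA.
have nUB : normalizes U B by move=> x y /(subvP sU); apply: nB.
have [v0 [v0A v0B Uv0]] := wU A B nUA nUB sBA AB.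
pose w i := iter i (lie z) v0.
have wA i : w i \in A by elim: i => //= i IHi; apply: nA.
have Uw i x : x \in U -> ⁅x, w i⁆ \in B.
  elim: i x => [|i IHi] x xU; first exact: Uv0.
  by rewrite [w _]/= lie_derivation memvD ?IHi ?Uz // nB ?IHi.
have w_ex : exists i, w i \in B by exists k; rewrite /w z_nil mem0v.
case: (ex_minnP w_ex) => -[|i] wB w_min; first by rewrite wB in v0B.
exists (w i); split=> // [|_ /memv_add_lineP [u uU [c ->]]].
  by apply/negP => /w_min; rewrite ltnn.
by rewrite lieDl lieZl memvD ?Uw ?memvZ.
Qed.

(** A subalgebra [U] of [L] is enlarged one dimension at a time: the property
    of [U], applied to the quotient of [L] by [U], yields a vector [z] outside
    [U] normalizing [U], hence the larger subalgebra spanned by [U] and [z]. *)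
Lemma engel L : normalizes L L -> (forall x, x \in L -> ad_nilpotent x) ->
  invariants_in_quotients L.
Proof.
move=> LL L_nil.
suff [U [sUL dimU _ wU]] : exists U, [/\ (U <= L)%VS, \dim U = \dim L,
    normalizes U U & invariants_in_quotients U].
  by have /eqP <- // : U == L; rewrite eqEdim sUL dimU leqnn.
elim: {-2}(\dim L) (leqnn (\dim L)) => [_|k IHk lt_k].
  exists 0%VS; rewrite sub0v dimv0.
  split=> // [x y _|A B _ _ _ /subvPn [v vA vB]].
    by rewrite !memv0 => /eqP ->; rewrite linear0.
  exists v; split=> // x; rewrite memv0 => /eqP ->.
  by rewrite -[0](scale0r 0) lieZl scale0r mem0v.
have [U [sUL dimU UU wU]] := IHk (ltnW lt_k).
have nUL : normalizes U L by move=> x y /(subvP sUL); apply: LL.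
have [|z [zL zU Uz]] := wU L U nUL UU sUL.
  by apply: contraTN lt_k => /dimvS; rewrite dimU -leqNgt.
exists (U + <[z]>)%VS; split.
- by rewrite subv_add sUL -memvE.
- by rewrite dim_addv_line ?dimU.
- move=> _ _ /memv_add_lineP [u uU [c ->]] /memv_add_lineP [u' u'U [c' ->]].
  apply: (subvP (addvSl _ _)); rewrite lieDl !linearD /=.
  rewrite !lieZl !linearZ /= liexx.
  rewrite !scaler0 addr0 [⁅z, u'⁆]lieC.
  by rewrite !memvD ?memvZ ?memvN ?Uz ?UU.
- by apply: invariants_in_quotients_line => //; apply: L_nil.
Qed.

(** By Engel's theorem, a flag of ideals [B] of [L] with [L] acting trivially on
    the successive quotients reaches codimension one. Then [L] acts trivially on
    [L / B] too, so that [B] contains the brackets. *)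
Lemma lie_derived_proper L : normalizes L L ->
  (forall x, x \in L -> ad_nilpotent x) -> L != 0%VS ->
  (\dim (lie_derived L) < \dim L)%N.
Proof.
move=> LL L_nil L_neq0; have wL := engel LL L_nil.
have Lgt0 : (0 < \dim L)%N by rewrite lt0n dimv_eq0.
have flag k : (k < \dim L)%N ->
  exists B, [/\ (B <= L)%VS, \dim B = k & normalizes L B].
  elim: k => [_|k IHk lt_k].
    exists 0%VS; rewrite sub0v dimv0; split=> // x y _.
    by rewrite !memv0 => /eqP ->; rewrite linear0.
  have [B [sBL dimB LB]] := IHk (ltnW lt_k).
  have [|v [vL vB Lv]] := wL L B LL LB sBL.
    by apply: contraTN lt_k => /dimvS; rewrite dimB -leqNgt => /leq_trans ->.
  exists (B + <[v]>)%VS; split; first by rewrite subv_add sBL -memvE.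
    by rewrite dim_addv_line ?dimB.
  move=> x _ xL /memv_add_lineP [u uB [c ->]]; apply: (subvP (addvSl _ _)).
  by rewrite linearD /= linearZ /= memvD ?memvZ ?Lv ?LB.
have [|B [sBL dimB LB]] := flag (\dim L).-1; first by rewrite ltn_predL.
have [|v [vL vB Lv]] := wL L B LL LB sBL.
  apply: contraL Lgt0 => /dimvS; rewrite dimB.
  by case: (\dim L) => // d; rewrite ltnn.
have eqL : L = (B + <[v]>)%VS.
  apply/eqP; rewrite eq_sym eqEdim subv_add sBL -memvE vL /=.
  by rewrite dim_addv_line // dimB prednK.
rewrite -(prednK Lgt0) ltnS -dimB; apply/dimvS/lie_derived_sub => x y xL.
rewrite {1}eqL => /memv_add_lineP [u uB [c ->]].
by rewrite linearD /= linearZ /= memvD ?memvZ ?Lv ?LB.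
Qed.

Lemma ad_nilpotent_solvable L : normalizes L L ->
  (forall x, x \in L -> ad_nilpotent x) -> lie_solvable L.
Proof.
have [d] := ubnP (\dim L); elim: d => // d IHd in L *.
rewrite ltnS => le_d LL L_nil.
have [->|L_neq0] := eqVneq L 0%VS; first by exists 0%N.
have sDL : (lie_derived L <= L)%VS by apply: lie_derived_sub => x y; apply: LL.
have [||x xD|m m0] := IHd (lie_derived L).
- exact: leq_trans (lie_derived_proper LL L_nil L_neq0) le_d.
- by move=> x y /(subvP sDL) xL /(subvP sDL) yL; apply: mem_lie_derived.
- by apply: L_nil; apply: (subvP sDL).
by exists m.+1; rewrite iterSr.
Qed.

End Engel.

(** Cartan's criterion: the radical of the Killing form is an ideal, and it is
    solvable because its derived algebra consists of [ad]-nilpotent elements. *)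
Lemma semisimple_killing_radical (R : rcfType) (g : lieAlgType R) :
  semisimple g -> killing_radical g = 0%VS.
Proof.
move=> ss; have idN := @killing_radical_ideal R g.
apply: ss => //.
have [||m m0] := @ad_nilpotent_solvable R g (lie_derived (killing_radical g)).
- have sD : (lie_derived (killing_radical g) <= killing_radical g)%VS.
    by apply: lie_derived_sub => x y _; apply: idN.
  by move=> x y /(subvP sD) xN /(subvP sD) yN; apply: mem_lie_derived.
- exact: derived_radical_nilpotent.
by exists m.+1; rewrite iterSr.
Qed.

(** * Linear functions on a vector space *)

Section LinearFunctionsSmooth.
Variables (R : realType) (n : nat) (L : {linear 'rV[R]_n -> R^o}).

Lemma rV_linear_continuous : continuous L.
Proof.
have -> : (L : _ -> R) = \sum_i (fun c : 'rV[R]_n => c 0 i * L (delta_mx 0 i)).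
  apply/funext => c; rewrite {1}(row_sum_delta c) linear_sum fct_sumE.
  by apply: eq_bigr => i _; rewrite linearZ.
elim/big_ind: _ => [x|f h cf ch x|i _ x].
- exact: (@cst_continuous _ _ (0 : R) x).
- exact: (continuousD (cf x) (ch x)).
apply: (@continuousM R _ (fun c : 'rV[R]_n => c 0 i) (fun=> L _)).
  exact: coord_continuous.
exact: cst_continuous.
Qed.

Lemma Ck_cst k (a : R) : Ck k (cst a : 'rV[R]_n -> R).
Proof.
elim: k a => [|k IHk] a /=; first exact: cst_continuous.
split=> [x|v]; first exact: differentiable_cst.
suff -> : 'D_v (cst a : 'rV[R]_n -> R) = cst 0 by [].
by apply/funext => x; rewrite derive_cst.
Qed.

Lemma Ck_linear k : Ck k L.
Proof.
case: k => [|k]; first exact: rV_linear_continuous.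
have dL x : differentiable L x.
  by apply: linear_differentiable; apply: rV_linear_continuous.
split=> // v; suff -> : 'D_v L = cst (L v) by apply: Ck_cst.
apply/funext => x; rewrite deriveE // diff_lin //.
exact: rV_linear_continuous.
Qed.

End LinearFunctionsSmooth.

Section LinearFunctions.
Variables (R : realType) (V : vectType R).
Implicit Types (alpha : @covec R V).
Let e_basis : basis_of {:V} (vbasis {:V}). Proof. exact: vbasisP. Qed.

Lemma smooth_covec alpha : smooth alpha.
Proof.
move=> k; rewrite /in_chart.
pose L : {linear 'rV[R]_(\dim {:V}) -> R^o} := alpha \o vecof (vbasis {:V}).
exact: (Ck_linear L k).
Qed.

Lemma dform_covec alpha xi : dform alpha xi = alpha.
Proof.
apply/lfunP => eta; rewrite /dform /in_chart.
pose L : {linear 'rV[R]_(\dim {:V}) -> R^o} := alpha \o vecof (vbasis {:V}).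
rewrite lfunE /= -[alpha \o _]/(L : _ -> _).
rewrite (diff_lin _ (rV_linear_continuous (L := L))).
by rewrite /L /= rVofK.
Qed.

End LinearFunctions.

(** * The double bracket field *)

Section DoubleBracket.
Variables (R : realType) (g : lieAlgType R).
Hypothesis rad0 : killing_radical g = 0%VS.
Implicit Types (x y v w xi : g) (F H G : g -> R) (alpha beta : @covec R g).

Lemma killing_inj v w : (forall x, killing v x = killing w x) -> v = w.
Proof.
move=> vw; apply/eqP; rewrite -subr_eq0 -memv0 -rad0.
apply/killing_radicalP => x.
by rewrite killingC linearB /= killingC vw (killingC w) subrr.
Qed.

Lemma covec_inj v w : (forall alpha, alpha v = alpha w) -> v = w.
Proof.
move=> vw; apply: killing_inj => x.
by rewrite killingC -killing_flatE vw killing_flatE killingC.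
Qed.

Lemma killing_grad F xi x : killing (grad killing F xi) x = dform F xi x.
Proof. exact: (xgetPex 0 (killing_repr rad0 (dform F xi)) x). Qed.

Lemma covecE alpha xi x : alpha x = killing (grad killing alpha xi) x.
Proof. by rewrite killing_grad dform_covec. Qed.

Lemma grad_dform F xi : grad killing (dform F xi) xi = grad killing F xi.
Proof.
apply: killing_inj => x.
exact: etrans (esym (covecE (dform F xi) xi x)) (esym (killing_grad F xi x)).
Qed.

(** Every covector is the differential of a smooth function, namely itself, so
    that the values of the tensor on differentials determine it. *)
Lemma poisson_tensor_covec xi alpha beta :
  poisson_tensor lie_poisson xi alpha beta =
  killing xi ⁅grad killing alpha xi, grad killing beta xi⁆.
Proof.
pose P alpha beta := killing xi ⁅grad killing alpha xi, grad killing beta xi⁆.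
rewrite -{1}(dform_covec alpha xi) -{1}(dform_covec beta xi).
have ex : exists Q : covec -> covec -> R, forall F H, smooth F -> smooth H ->
    Q (dform F xi) (dform H xi) = lie_poisson F H xi.
  exists P => F H _ _.
  exact: (congr2 (fun v w => killing xi ⁅v, w⁆) (grad_dform F xi)
    (grad_dform H xi)).
exact: (xgetPex (fun _ _ => 0) ex _ _ (smooth_covec alpha) (smooth_covec beta)).
Qed.

(** [ad] is skew for the Killing form. *)
Lemma sharp_grad xi alpha :
  sharp lie_poisson xi alpha = - ⁅xi, grad killing alpha xi⁆.
Proof.
have sharpP beta : beta (- ⁅xi, grad killing alpha xi⁆) =
    poisson_tensor lie_poisson xi beta alpha.
  rewrite poisson_tensor_covec (covecE beta xi) -[in RHS]killing_invariant.
  by rewrite killing_ad_skew killingNr.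
by apply: xget_unique => // v vP; apply: covec_inj => beta; rewrite vP -sharpP.
Qed.

Lemma double_bracket_field_grad G xi :
  double_bracket_field lie_poisson killing_metric G xi
  = ⁅xi, ⁅xi, grad killing G xi⁆⁆.
Proof.
have fieldP alpha : alpha ⁅xi, ⁅xi, grad killing G xi⁆⁆ =
    - cometric_tensor lie_poisson killing_metric xi (dform G xi) alpha.
  rewrite /cometric_tensor /killing_metric !sharp_grad grad_dform.
  rewrite (covecE alpha xi).
  by rewrite killingNr opprK [RHS]killingC killingNr killing_ad_skew opprK.
by apply: xget_unique => // v vP; apply: covec_inj => alpha; rewrite vP -fieldP.
Qed.

End DoubleBracket.

Theorem theorem2p1 (R : realType) (g : lieAlgType R) (ss : semisimple g)
    (G : g -> R) (smoothG : smooth G) (xi : g) :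
  double_bracket_field lie_poisson killing_metric G xi
  = ⁅xi, ⁅xi, grad killing G xi⁆⁆.
Proof.
exact: (double_bracket_field_grad (semisimple_killing_radical ss)).
Qed.
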